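(* Let $n\ge 1$ and let $\Phi[t_1,\ldots,t_n]$ be a lattice-linear expression in the formal variables $t_1,\ldots,t_n$. If $\Phi$ vanishes on $\mathbb{R}$, that is, $\Phi(\lambda_1,\ldots,\lambda_n)=0$ for all $\lambda_1,\ldots,\lambda_n\in\mathbb{R}$, then $\Phi$ vanishes on every vector lattice $X$, that is, $\Phi(x_1,\ldots,x_n)=0$ for all $x_1,\ldots,x_n\in X$.
   Context: Vector lattices are real and are not assumed to be Archimedean. A lattice-linear expression in the formal variables $t_1,\ldots,t_n$ is a formal expression constructed inductively: (i) $0$ is a lattice-linear expression; (ii) each $t_i$ ($1\le i\le n$) is a lattice-linear expression; (iii) if $\Phi_1,\Phi_2$ are lattice-linear expressions in $t_1,\ldots,t_n$, then so are $\Phi_1+\Phi_2$, $\lambda\Phi_1$ (for $\lambda\in\mathbb{R}$), $\Phi_1\vee\Phi_2$ and $\Phi_1\wedge\Phi_2$. Given a vector lattice $X$ and $x_1,\ldots,x_n\in X$, the evaluation $\Phi(x_1,\ldots,x_n)\in X$ is defined recursively by interpreting $0$ as $0\in X$, $t_i$ as $x_i$, and the formal operations $+$, $\lambda\,\cdot$, $\vee$, $\wedge$ as the corresponding operations of $X$. $\Phi$ vanishes on $X$ if $\Phi(x_1,\ldots,x_n)=0$ for all $x_1,\ldots,x_n\in X$. The real line $\mathbb{R}$ is a vector lattice with its usual order. *)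

(* Defs.v *)
From HB Require Import structures.
From mathcomp Require Import all_boot all_order all_algebra reals.

Set Implicit Arguments.
Unset Strict Implicit.
Unset Printing Implicit Defensive.

Import Order.TTheory GRing.Theory Num.Theory.

Local Open Scope ring_scope.

#[short(type="porderLmodType")]
HB.structure Definition POrderedLmodule (R : pzRingType) :=
  { V of Num.POrderedZmodule V & GRing.Lmodule R V }.

HB.mixin Record POrderedLmodule_isOrdered (R : realType) V
    of POrderedLmodule R V := {
  ovs_leD2r : forall x y z : V, x <= y -> x + z <= y + z ;
  ovs_scaler_ge0 : forall (a : R) (x : V), 0 <= a -> 0 <= x -> 0 <= a *: x
}.

#[short(type="orderedVectorSpaceType")]
HB.structure Definition OrderedVectorSpace (R : realType) :=
  { V of POrderedLmodule R V & POrderedLmodule_isOrdered R V }.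

(* [vmeetP] and [vjoinP] are the axioms of [Order.POrder_MeetJoin_isLattice].
   They are restated because HB accepts no structure inheriting from both
   [GRing.Zmodule] and [Order.Lattice] that is not an ancestor of
   [Num.RealDomain], where the two hierarchies already join. *)
HB.mixin Record OrderedVectorSpace_isVectorLattice (R : realType) V
    of OrderedVectorSpace R V := {
  vmeet : V -> V -> V ;
  vjoin : V -> V -> V ;
  vmeetP : forall x y z : V, (x <= vmeet y z) = (x <= y) && (x <= z) ;
  vjoinP : forall x y z : V, (vjoin x y <= z) = (x <= z) && (y <= z)
}.

#[short(type="vectorLatticeType")]
HB.structure Definition VectorLattice (R : realType) :=
  { V of OrderedVectorSpace R V & OrderedVectorSpace_isVectorLattice R V }.

(* The real line: on [R^o] the scaling is the multiplication of [R] and the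
   order is that of [R]. *)
Section RealLine.
Variable R : realType.

Fact regular_leD2r (x y z : R^o) : x <= y -> x + z <= y + z.
Proof. by rewrite lerD2r. Qed.

Fact regular_scaler_ge0 (a : R) (x : R^o) : 0 <= a -> 0 <= x -> 0 <= a *: x.
Proof. exact: mulr_ge0. Qed.

Fact regular_meetP (x y z : R^o) :
  (x <= Num.min y z) = (x <= y) && (x <= z).
Proof. exact: le_min. Qed.

Fact regular_joinP (x y z : R^o) :
  (Num.max x y <= z) = (x <= z) && (y <= z).
Proof. exact: ge_max. Qed.

HB.instance Definition _ := Num.POrderedZmodule.on R^o.

HB.instance Definition _ :=
  POrderedLmodule_isOrdered.Build R R^o regular_leD2r regular_scaler_ge0.

HB.instance Definition _ :=
  OrderedVectorSpace_isVectorLattice.Build R R^o regular_meetP regular_joinP.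

End RealLine.

Inductive lattice_expr (R : realType) (n : nat) : Type :=
| LZero
| LVar of 'I_n
| LAdd of lattice_expr R n & lattice_expr R n
| LScale of R & lattice_expr R n
| LJoin of lattice_expr R n & lattice_expr R n
| LMeet of lattice_expr R n & lattice_expr R n.

Fixpoint lattice_eval (R : realType) (n : nat) (X : vectorLatticeType R)
    (x : 'I_n -> X) (Phi : lattice_expr R n) : X :=
  match Phi with
  | LZero => 0
  | LVar i => x i
  | LAdd Phi1 Phi2 => lattice_eval x Phi1 + lattice_eval x Phi2
  | LScale a Phi1 => a *: lattice_eval x Phi1
  | LJoin Phi1 Phi2 => vjoin (lattice_eval x Phi1) (lattice_eval x Phi2)
  | LMeet Phi1 Phi2 => vmeet (lattice_eval x Phi1) (lattice_eval x Phi2)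
  end.

Definition vanishes_on (R : realType) (n : nat) (Phi : lattice_expr R n)
    (X : vectorLatticeType R) : Prop :=
  forall x : 'I_n -> X, lattice_eval x Phi = 0.

(* Main.v *)
Require Import Defs.
From mathcomp Require Import all_boot all_order all_algebra reals.
From mathcomp Require Import lra.

(** In every vector lattice, [Phi] and [- Phi] are finite suprema of finite
    infima of linear forms in the variables, with the same forms for all
    lattices.  If such a supremum is at most [0] on the real line, then none of
    its finite systems of forms is simultaneously positive at a real point.
    Fourier-Motzkin elimination then derives [w <= 0] from the inequalities
    [w <= l x], [l] in the system, using convex combinations only, so that the
    derivation is valid in every ordered vector space. *)

Set Implicit Arguments.
Unset Strict Implicit.
Unset Printing Implicit Defensive.

Import Order.TTheory GRing.Theory Num.Theory.

Local Open Scope ring_scope.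

(** * Order arithmetic in ordered vector spaces *)

Section OrderedVectorSpaces.
Variables (R : realType) (X : orderedVectorSpaceType R).
Implicit Types (x y z : X) (a b : R).

Lemma ovs_leD2rE z x y : (x + z <= y + z) = (x <= y).
Proof.
apply/idP/idP => [/(ovs_leD2r _ _ (- z))|]; first by rewrite !addrK.
exact: ovs_leD2r.
Qed.

Lemma ovs_subr_ge0 x y : (0 <= y - x) = (x <= y).
Proof. by rewrite -(ovs_leD2rE x 0) subrK add0r. Qed.

Lemma ovs_leBlDr x y z : (x - y <= z) = (x <= z + y).
Proof. by rewrite -(ovs_leD2rE y (x - y)) subrK. Qed.

Lemma ovs_leBrDr x y z : (x <= y - z) = (x + z <= y).
Proof. by rewrite -(ovs_leD2rE z x) subrK. Qed.

Lemma ovs_leN2 x y : (- x <= - y) = (y <= x).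
Proof. by rewrite -(ovs_subr_ge0 (- x)) opprK addrC ovs_subr_ge0. Qed.

Lemma ovs_leD x1 y1 x2 y2 : x1 <= y1 -> x2 <= y2 -> x1 + x2 <= y1 + y2.
Proof.
move=> le1 le2; apply: le_trans (ovs_leD2r _ _ x2 le1) _.
by rewrite ![y1 + _]addrC ovs_leD2rE.
Qed.

Lemma ovs_ler_wpZ2l a x y : 0 <= a -> x <= y -> a *: x <= a *: y.
Proof.
rewrite -(ovs_subr_ge0 x) -(ovs_subr_ge0 (a *: x)) -scalerBr.
exact: ovs_scaler_ge0.
Qed.

Lemma ovs_ler_pZ2l a x y : 0 < a -> (a *: x <= a *: y) = (x <= y).
Proof.
move=> a0; apply/idP/idP; last exact/ovs_ler_wpZ2l/ltW.
have ai0 : 0 <= a^-1 by rewrite invr_ge0 ltW.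
by move/(ovs_ler_wpZ2l ai0); rewrite !scalerA mulVf ?gt_eqF// !scale1r.
Qed.

End OrderedVectorSpaces.

(** * Meets, joins and negation in vector lattices *)

Section VectorLattices.
Variables (R : realType) (X : vectorLatticeType R).
Implicit Types x y z : X.

Lemma vmeetC x y : vmeet x y = vmeet y x.
Proof.
have le u v : vmeet u v <= vmeet v u by rewrite vmeetP andbC -vmeetP.
by apply/le_anti; rewrite !le.
Qed.

Lemma vjoin_opp x y : - vjoin x y = vmeet (- x) (- y).
Proof.
apply/le_anti; rewrite vmeetP !ovs_leN2 -vjoinP lexx /=.
rewrite -(opprK (vmeet _ _)) ovs_leN2 vjoinP.
by rewrite -(ovs_leN2 _ x) -(ovs_leN2 _ y) opprK -vmeetP lexx.
Qed.

Lemma vmeet_opp x y : - vmeet x y = vjoin (- x) (- y).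
Proof. by rewrite -[RHS]opprK vjoin_opp !opprK. Qed.

(** Since the meet lies below [y] and [x], the vector [x + y - vmeet x y] lies above [x] and [y],
    hence above their join; the converse inequality is dual. *)
Lemma vmeet_add_vjoin x y : vmeet x y + vjoin x y = x + y.
Proof.
apply/le_anti/andP; split.
  rewrite addrC -ovs_leBrDr vjoinP !ovs_leBrDr.
  have := lexx (vmeet x y); rewrite vmeetP => /andP[mx my].
  by rewrite (ovs_leD (lexx x) my) addrC (ovs_leD mx (lexx y)).
rewrite -ovs_leBlDr vmeetP !ovs_leBlDr.
have := lexx (vjoin x y); rewrite vjoinP => /andP[xj yj].
by rewrite (ovs_leD (lexx x) yj) addrC (ovs_leD (lexx y) xj).
Qed.

End VectorLattices.

(** * Linear forms as coefficient rows *)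

Section LinearForms.
Variables (R : realType) (n : nat).
Implicit Types (l : 'rV[R]_n) (s : seq 'rV[R]_n).

Definition lform (X : lmodType R) (x : 'I_n -> X) l : X :=
  \sum_i l 0 i *: x i.

Lemma lform0 (X : lmodType R) (x : 'I_n -> X) : lform x 0 = 0.
Proof. by rewrite /lform big1// => i _; rewrite mxE scale0r. Qed.

Lemma lformD (X : lmodType R) (x : 'I_n -> X) l1 l2 :
  lform x (l1 + l2) = lform x l1 + lform x l2.
Proof.
by rewrite /lform -big_split; apply: eq_bigr => i _; rewrite mxE scalerDl.
Qed.

Lemma lformZ (X : lmodType R) (x : 'I_n -> X) a l :
  lform x (a *: l) = a *: lform x l.
Proof.
by rewrite /lform scaler_sumr; apply: eq_bigr => i _; rewrite mxE scalerA.
Qed.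

Lemma lform_delta (X : lmodType R) (x : 'I_n -> X) i :
  lform x (delta_mx 0 i) = x i.
Proof.
rewrite /lform (bigD1 i)//= big1 => [|j ji]; first by rewrite mxE !eqxx scale1r addr0.
by rewrite mxE (negPf ji) andbF scale0r.
Qed.

Lemma lform_shift (t : 'I_n -> R^o) (k : 'I_n) (a : R) l :
  lform (fun i => t i + a *+ (i == k) : R^o) l = lform t l + a * l 0 k.
Proof.
rewrite /lform [in LHS](bigD1 k)//= [in RHS](bigD1 k)//= eqxx.
rewrite (eq_bigr (fun i => l 0 i *: t i)) => [|i /negPf->]; last by rewrite addr0.
by rewrite scalerDr addrAC [a * _]mulrC.
Qed.

End LinearForms.

(** * Strict separation of finite sets of reals *)

Section Separation.
Variable R : realFieldType.
Implicit Types (A B : seq R) (a : R).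

Lemma seq_lt_between a B : (forall b, b \in B -> a < b) ->
  exists2 c, a < c & forall b, b \in B -> c < b.
Proof.
elim: B => [|b B IH] aB; first by exists (a + 1); rewrite ?ltrDl.
have [|c ac cB] := IH; first by move=> d dB; apply: aB; rewrite inE dB orbT.
have ab : a < b by apply: aB; rewrite inE eqxx.
have [bc|cb] := leP b c; last first.
  by exists c => // d /[!inE]/orP[/eqP->|/cB].
exists ((a + b) / 2); first lra.
move=> d /[!inE]/orP[/eqP->|/cB]; lra.
Qed.

(** Either list may be empty, as happens when the variable to eliminate occurs with one sign
    only. *)
Lemma seq_separation A B : {in A & B, forall a b, a < b} ->
  exists c, {in A, forall a, a < c} /\ {in B, forall b, c < b}.
Proof.
elim: A => [_|a A IH AB].
  elim: B => [|b B [c [_ cB]]]; first by exists 0.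
  exists (Num.min b c - 1); split=> // d /[!inE] /orP[/eqP->|/cB cd].
    by rewrite ltrBlDr gt_min ltrDl ltr01.
  by rewrite ltrBlDr gt_min orbC (lt_trans cd)// ltrDl ltr01.
have [|c [Ac cB]] := IH.
  by move=> d b dA; apply: AB; rewrite inE dA orbT.
have [ac|ca] := ltP a c.
  by exists c; split=> // d /[!inE] /orP[/eqP->|/Ac].
have [b bB|e ae eB] := @seq_lt_between a B.
  by apply: AB; rewrite ?inE ?eqxx.
exists e; split=> // d /[!inE] /orP[/eqP->//|/Ac dc].
exact: lt_trans dc (le_lt_trans ca ae).
Qed.

End Separation.

(** * Fourier-Motzkin elimination *)

Section FourierMotzkin.
Variables (R : realType) (n : nat).
Implicit Types (k : 'I_n) (l p q : 'rV[R]_n) (s : seq 'rV[R]_n).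

(* The convex combination of [p] and [q] without the variable of index [k],
   when the coefficients of [p] and [q] there have opposite signs. *)
Definition fm_combine k p q : 'rV[R]_n :=
  (p 0 k - q 0 k)^-1 *: (p 0 k *: q + - q 0 k *: p).

Definition fm_eliminate k s : seq 'rV[R]_n :=
  [seq l : 'rV_n <- s | l 0 k == 0] ++
  [seq fm_combine k p q | p <- [seq l : 'rV_n <- s | 0 < l 0 k],
                          q <- [seq l : 'rV_n <- s | l 0 k < 0]].

Lemma fm_eliminateP k s l : l \in fm_eliminate k s ->
  (l \in s /\ l 0 k = 0) \/
  exists p q, [/\ p \in s, q \in s, 0 < p 0 k, q 0 k < 0 & l = fm_combine k p q].
Proof.
rewrite mem_cat mem_filter => /orP[/andP[/eqP]|]; first by left.
case/allpairsP => -[p q] /= [].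
rewrite !mem_filter => /andP[p0 ps] /andP[q0 qs] ->.
by right; exists p, q.
Qed.

(** Variables eliminated earlier do not come back, so elimination can be iterated. *)
Lemma fm_eliminate_vanish k s i : (forall l, l \in s -> l 0 i = 0) ->
  forall l, l \in fm_eliminate k s -> l 0 i = 0.
Proof.
move=> s0 l /fm_eliminateP[[/s0//]|[p [q [/s0 p0 /s0 q0 _ _ ->]]]].
by rewrite !mxE p0 q0 !mulr0 addr0 mulr0.
Qed.

Lemma fm_eliminate_var k s l : l \in fm_eliminate k s -> l 0 k = 0.
Proof.
move=> /fm_eliminateP[[]//|[p [q [_ _ _ _ ->]]]].
by rewrite !mxE mulrC mulNr [p 0 k * _]mulrC subrr mul0r.
Qed.

(** The weights in [fm_combine] are nonnegative with sum 1, so a common lower bound of [p] and [q]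
    survives. The proof clears the denominator and splits the multiple of [w] accordingly. *)
Lemma fm_eliminate_lower (X : orderedVectorSpaceType R) (x : 'I_n -> X) w k s :
  (forall l, l \in s -> w <= lform x l) ->
  forall l, l \in fm_eliminate k s -> w <= lform x l.
Proof.
move=> ws l /fm_eliminateP[[/ws//]|[p [q [ps qs p0 q0 ->]]]].
have d0 : 0 < p 0 k - q 0 k by lra.
rewrite -(ovs_ler_pZ2l _ _ d0) lformZ scalerA divff ?gt_eqF// scale1r.
rewrite lformD !lformZ scalerDl.
by apply: ovs_leD; apply: ovs_ler_wpZ2l; rewrite ?ws ?oppr_ge0// ltW.
Qed.

Lemma fm_eliminate_solution k s (t : 'I_n -> R^o) :
  (forall l, l \in fm_eliminate k s -> 0 < lform t l) ->
  exists u : 'I_n -> R^o, forall l, l \in s -> 0 < lform u l.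
Proof.
(* [bound l] is the shift of coordinate [k] at which [l] vanishes: the required shift must exceed it
   if [l 0 k] is positive and stay below it if [l 0 k] is negative. *)
move=> pos_t; pose bound l : R := - (lform t l : R) / l 0 k.
have [|a [lo hi]] := @seq_separation R
    (map bound [seq l : 'rV_n <- s | 0 < l 0 k])
    (map bound [seq l : 'rV_n <- s | l 0 k < 0]).
  move=> _ _ /mapP[p pP ->] /mapP[q qN ->].
  (* Up to positive factors, positivity of the combined form at [t] is the inequality
     [bound p < bound q]. *)
  have /pos_t : fm_combine k p q \in fm_eliminate k s.
    by rewrite mem_cat allpairs_f ?orbT.
  move: pP qN; rewrite !mem_filter => /andP[p0 _] /andP[q0 _].
  have d0 : 0 < p 0 k - q 0 k by lra.
  rewrite lformZ lformD !lformZ => pos.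
  have {}pos : 0 < p 0 k * (lform t q : R) + - q 0 k * (lform t p : R).
    by move: pos; rewrite /GRing.scale/= pmulr_rgt0 ?invr_gt0.
  rewrite /bound ltr_pdivrMr// mulrAC ltr_ndivlMr//; lra.
exists (fun i => t i + a *+ (i == k)) => l ls; rewrite lform_shift.
have [l0|l0|l0] := ltgtP (l 0 k) 0.
- have /hi : bound l \in map bound [seq l : 'rV_n <- s | l 0 k < 0].
    by rewrite map_f// mem_filter l0.
  by rewrite /bound ltr_ndivlMr// => h; rewrite -ltrBlDl sub0r.
- have /lo : bound l \in map bound [seq l : 'rV_n <- s | 0 < l 0 k].
    by rewrite map_f// mem_filter l0.
  by rewrite /bound ltr_pdivrMr// => h; rewrite -ltrBlDl sub0r.
- by rewrite l0 mulr0 addr0 pos_t// mem_cat mem_filter l0 eqxx ls.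
Qed.

Lemma infeasible_lower_bound_le0 s :
  ~ (exists t : 'I_n -> R^o, forall l, l \in s -> 0 < lform t l) ->
  forall (X : orderedVectorSpaceType R) (x : 'I_n -> X) w,
  (forall l, l \in s -> w <= lform x l) -> w <= 0.
Proof.
move=> infeasible X x w.
(* Induction on [m], where only variables of index less than [m] may occur in [s]; each step
   eliminates the variable of index [m]. *)
have [m le_nm] : exists m, (n <= m)%N by exists n.
have : forall l, l \in s -> forall i : 'I_n, (m <= i)%N -> l 0 i = 0.
  by move=> l _ i mi; have := leq_trans (ltn_ord i) (leq_trans le_nm mi); rewrite ltnn.
elim: m s infeasible {le_nm} => [|m IH] s infeasible s0 ws.
  have z l : l \in s -> l = 0 by move=> ls; apply/rowP => i; rewrite mxE s0.
  (* The empty system is feasible, so [s] contains a form, which is zero and gives [w <= 0]. *)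
  case: s infeasible s0 ws z => [[]|l s _ _ ws z]; first by exists (fun=> 0).
  by have := ws l (mem_head _ _); rewrite (z l) ?mem_head// lform0.
have [mn|nm] := ltnP m n; last first.
  apply: (IH s) => // l ls i mi; apply: s0 => //.
  by have := leq_trans (ltn_ord i) (leq_trans nm mi); rewrite ltnn.
pose k := Ordinal mn.
apply: (IH (fm_eliminate k s)).
- by case=> t /fm_eliminate_solution.
- move=> l ls i; rewrite leq_eqVlt => /orP[/eqP mi|mi].
    by have -> : i = k; [exact/val_inj|exact: fm_eliminate_var ls].
  by apply: (fm_eliminate_vanish _ ls) => {ls}l ls; apply: s0.
- exact: fm_eliminate_lower.
Qed.

End FourierMotzkin.

(** * Suprema of infima of linear forms *)

Section NormalForm.
Variables (R : realType) (n : nat).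
Implicit Types (D : seq (seq 'rV[R]_n)) (s : seq 'rV[R]_n) (l : 'rV[R]_n).

Definition in_lower (X : vectorLatticeType R) (x : 'I_n -> X) D (w : X) :=
  exists2 s, s \in D & forall l, l \in s -> w <= lform x l.

(* [v] is the supremum over [s] in [D] of the infima of the [lform x l], [l] in
   [s]; replacing each infimum by the set of lower bounds spares the
   nonemptiness conditions. *)
Definition sup_inf (X : vectorLatticeType R) (x : 'I_n -> X) D (v : X) :=
  forall z, v <= z <-> forall w, in_lower x D w -> w <= z.

Lemma sup_inf_ub {X : vectorLatticeType R} {x : 'I_n -> X} {D v} :
  sup_inf x D v -> forall w, in_lower x D w -> w <= v.
Proof. by move=> /(_ v)[+ _]; apply. Qed.

Lemma sup_inf_least {X : vectorLatticeType R} {x : 'I_n -> X} {D v z} :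
  sup_inf x D v -> (forall w, in_lower x D w -> w <= z) -> v <= z.
Proof. by move=> /(_ z)[_ +]; apply. Qed.

Lemma sup_infI (X : vectorLatticeType R) (x : 'I_n -> X) D v :
  (forall w, in_lower x D w -> w <= v) ->
  (forall z, (forall w, in_lower x D w -> w <= z) -> v <= z) -> sup_inf x D v.
Proof. by move=> ub least z; split=> [vz w /ub/le_trans->|/least]. Qed.

Lemma sup_inf_lform (X : vectorLatticeType R) (x : 'I_n -> X) l :
  sup_inf x [:: [:: l]] (lform x l).
Proof.
apply: sup_infI => [w [s /[1!inE] /eqP->]|z]; first by apply; rewrite inE.
by apply; exists [:: l]; rewrite ?inE// => _ /[1!inE] /eqP->.
Qed.

Lemma sup_inf_join (X : vectorLatticeType R) (x : 'I_n -> X) D1 D2 v1 v2 :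
  sup_inf x D1 v1 -> sup_inf x D2 v2 -> sup_inf x (D1 ++ D2) (vjoin v1 v2).
Proof.
move=> S1 S2 z; rewrite vjoinP; split=> [/andP[v1z v2z] w [s]|zub].
  by rewrite mem_cat => /orP[] sD ws;
    [apply: le_trans (sup_inf_ub S1 _) v1z|apply: le_trans (sup_inf_ub S2 _) v2z];
    exists s.
apply/andP; split; [apply: (sup_inf_least S1)|apply: (sup_inf_least S2)] => w [s sD ws];
  by apply: zub; exists s => //; rewrite mem_cat sD ?orbT.
Qed.

(** Meets distribute over existing suprema. Writing [vmeet y v] as [y + v - vjoin y v] turns the
    goal into an upper bound on [v], to be checked on each [w]; there [vjoin y w <= vjoin y v]
    suffices. *)
Lemma vmeet_sup_inf_le (X : vectorLatticeType R) (x : 'I_n -> X) D v y z :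
  sup_inf x D v -> (forall w, in_lower x D w -> vmeet y w <= z) ->
  vmeet y v <= z.
Proof.
move=> S yz.
have meetE u : vmeet y u = y + u - vjoin y u.
  by rewrite -(vmeet_add_vjoin y u) addrK.
rewrite meetE ovs_leBlDr addrC -ovs_leBrDr.
apply: (sup_inf_least S) => w wD; rewrite ovs_leBrDr addrC -ovs_leBlDr.
apply: le_trans (yz w wD); rewrite meetE.
apply: ovs_leD => //; rewrite ovs_leN2 vjoinP.
have := lexx (vjoin y v); rewrite vjoinP => /andP[-> /=].
exact/le_trans/(sup_inf_ub S).
Qed.

Lemma sup_inf_meet (X : vectorLatticeType R) (x : 'I_n -> X) D1 D2 v1 v2 :
  sup_inf x D1 v1 -> sup_inf x D2 v2 ->
  sup_inf x [seq s1 ++ s2 | s1 <- D1, s2 <- D2] (vmeet v1 v2).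
Proof.
move=> S1 S2; apply: sup_infI => [w [_ /allpairsP[[s1 s2] /= [D1s D2s ->]] ws]|z zub].
  rewrite vmeetP (sup_inf_ub S1) ?(sup_inf_ub S2)//.
    by exists s2 => // l ls; apply: ws; rewrite mem_cat ls orbT.
  by exists s1 => // l ls; apply: ws; rewrite mem_cat ls.
apply: (vmeet_sup_inf_le S2) => w2 [s2 D2s ws2].
rewrite vmeetC; apply: (vmeet_sup_inf_le S1) => w1 [s1 D1s ws1].
have := lexx (vmeet w2 w1); rewrite vmeetP => /andP[le2 le1].
apply: zub; exists (s1 ++ s2); first exact: allpairs_f.
move=> l; rewrite mem_cat => /orP[/ws1|/ws2]; exact: le_trans.
Qed.

(** Translations are order isomorphisms, so the bounds can be treated one summand at a time, with
    the other moved across the inequality. *)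
Lemma sup_inf_add (X : vectorLatticeType R) (x : 'I_n -> X) D1 D2 v1 v2 :
  sup_inf x D1 v1 -> sup_inf x D2 v2 ->
  sup_inf x [seq [seq l1 + l2 | l1 <- s1, l2 <- s2] | s1 <- D1, s2 <- D2]
    (v1 + v2).
Proof.
move=> S1 S2; apply: sup_infI => [w [_ /allpairsP[[s1 s2] /= [D1s D2s ->]] ws]|z zub].
  rewrite addrC -ovs_leBlDr; apply: (sup_inf_ub S2); exists s2 => // l2 ls2.
  rewrite ovs_leBlDr addrC -ovs_leBlDr.
  apply: (sup_inf_ub S1); exists s1 => // l1 ls1.
  by rewrite ovs_leBlDr -lformD; apply: ws; apply: allpairs_f.
rewrite -ovs_leBrDr; apply: (sup_inf_least S1) => w1 [s1 D1s ws1].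
rewrite ovs_leBrDr addrC -ovs_leBrDr; apply: (sup_inf_least S2) => w2 [s2 D2s ws2].
rewrite ovs_leBrDr; apply: zub.
exists [seq l1 + l2 | l1 <- s1, l2 <- s2]; first exact: (allpairs_f (fun s1 s2 => _)).
move=> _ /allpairsP[[l1 l2] /= [ls1 ls2 ->]].
by rewrite lformD addrC; apply: ovs_leD; [exact: ws1|exact: ws2].
Qed.

Lemma sup_inf_scale (X : vectorLatticeType R) (x : 'I_n -> X) D v (a : R) :
  0 < a -> sup_inf x D v ->
  sup_inf x [seq [seq a *: l | l <- s] | s <- D] (a *: v).
Proof.
move=> a0 S.
have aV (u : X) : u = a *: (a^-1 *: u) by rewrite scalerA divff ?gt_eqF// scale1r.
apply: sup_infI => [w [_ /mapP[s Ds ->] ws]|z zub].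
  rewrite [w]aV ovs_ler_pZ2l//; apply: (sup_inf_ub S); exists s => // l ls.
  by rewrite -(ovs_ler_pZ2l _ _ a0) -aV -lformZ; apply: ws; apply: map_f.
rewrite [z]aV ovs_ler_pZ2l//; apply: (sup_inf_least S) => w [s Ds ws].
rewrite -(ovs_ler_pZ2l _ _ a0) -aV; apply: zub.
exists [seq a *: l | l <- s]; first exact: (map_f (map _)).
by move=> _ /mapP[l ls ->]; rewrite lformZ ovs_ler_pZ2l// ws.
Qed.

(** This transfers nonpositivity from the real line: a system in [D] positive at a real point [t]
    would make [v] positive at [t], so every system is infeasible and its lower bounds in [X] are at
    most 0. *)
Lemma sup_inf_le0 D (v : forall X : vectorLatticeType R, ('I_n -> X) -> X) :
  (forall X x, sup_inf x D (v X x)) ->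
  (forall t : 'I_n -> R^o, v R^o t <= 0) -> forall X x, v X x <= 0.
Proof.
move=> S le0 X x; apply: (sup_inf_least (S X x)) => w [s Ds ws].
apply: (@infeasible_lower_bound_le0 _ _ s _ X x) => // -[t pos_t].
(* A positive [c] below all the values at [t] is a lower bound of the system, also when [s] is
   empty, hence [c <= v R^o t]. *)
have [|c c0 lt_c] := @seq_lt_between R 0 [seq (lform t l : R) | l <- s].
  by move=> _ /mapP[l ls ->]; apply: pos_t.
have : (c : R^o) <= v R^o t.
  apply: (sup_inf_ub (S R^o t)); exists s => // l ls.
  exact/ltW/lt_c/map_f.
by move=> /le_trans/(_ (le0 t)) /(lt_le_trans c0); rewrite ltxx.
Qed.

(* Treating [Phi] and [- Phi] together handles negative scalars without
   distributing a finite infimum over suprema. *)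
Lemma lattice_expr_sup_inf (Phi : lattice_expr R n) :
  exists D1 D2, forall (X : vectorLatticeType R) (x : 'I_n -> X),
  sup_inf x D1 (lattice_eval x Phi) /\ sup_inf x D2 (- lattice_eval x Phi).
Proof.
have zero (X : vectorLatticeType R) (x : 'I_n -> X) : sup_inf x [:: [:: 0]] 0.
  by rewrite -[X in sup_inf _ _ X](lform0 x); apply: sup_inf_lform.
elim: Phi => [|i|P [D1 [D2 IHP]] Q [E1 [E2 IHQ]]|a P [D1 [D2 IHP]]
    |P [D1 [D2 IHP]] Q [E1 [E2 IHQ]]|P [D1 [D2 IHP]] Q [E1 [E2 IHQ]]] /=.
- by exists [:: [:: 0]], [:: [:: 0]] => X x; rewrite oppr0.
- exists [:: [:: delta_mx 0 i]], [:: [:: -1 *: delta_mx 0 i]] => X x.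
  rewrite -[in - x i]scaleN1r -[x i](lform_delta x) -lformZ.
  by split; apply: sup_inf_lform.
- eexists; eexists => X x; have [P1 P2] := IHP X x; have [Q1 Q2] := IHQ X x.
  by rewrite opprD; split; apply: sup_inf_add; eassumption.
- have [a0|a0|->] := ltgtP a 0.
  + eexists; eexists => X x; have [P1 P2] := IHP X x.
    (* A negative scalar exchanges the families of [P] and of its opposite. *)
    have aE (u : X) : a *: u = (- a) *: (- u) by rewrite scalerN scaleNr opprK.
    by rewrite -scaleNr aE; split; apply: sup_inf_scale; rewrite ?oppr_gt0; eassumption.
  + eexists; eexists => X x; have [P1 P2] := IHP X x.
    by rewrite -scalerN; split; apply: sup_inf_scale; eassumption.
  + by exists [:: [:: 0]], [:: [:: 0]] => X x; rewrite scale0r oppr0.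
- eexists; eexists => X x; have [P1 P2] := IHP X x; have [Q1 Q2] := IHQ X x.
  by rewrite vjoin_opp; split;
    [apply: sup_inf_join|apply: sup_inf_meet]; eassumption.
- eexists; eexists => X x; have [P1 P2] := IHP X x; have [Q1 Q2] := IHQ X x.
  by rewrite vmeet_opp; split;
    [apply: sup_inf_meet|apply: sup_inf_join]; eassumption.
Qed.

End NormalForm.

Theorem theorem3p4 (R : realType) (n : nat) (hn : (1 <= n)%N)
    (Phi : lattice_expr R n) :
  vanishes_on Phi R^o ->
  forall X : vectorLatticeType R, vanishes_on Phi X.
Proof.
move=> vanish X x; have [D1 [D2 S]] := lattice_expr_sup_inf Phi.
apply/le_anti/andP; split.
  apply: (sup_inf_le0 (D := D1)
    (v := fun X x => lattice_eval x Phi)) => [Y y|t].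
    by have [] := S Y y.
  by rewrite vanish lexx.
(* The other inequality is the same transfer applied to the opposite of [Phi], which also vanishes
   on the real line. *)
rewrite -ovs_leN2 oppr0.
apply: (sup_inf_le0 (D := D2)
  (v := fun X x => - lattice_eval x Phi)) => [Y y|t].
  by have [] := S Y y.
by rewrite vanish oppr0 lexx.
Qed.
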